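(* Let $E$ be a Banach lattice. The following hold. (i) $\text{r-l-LW}(E)$ is a subalgebra of $\mathrm{L}_r(E)$. Moreover, $\text{r-l-LW}(E)=\mathrm{L}_r(E)$ if and only if the identity operator $I_E$ belongs to $\text{l-LW}(E)$. (ii) If $E$ is Dedekind complete, then $(\text{r-l-LW}(E),\|\cdot\|_{\text{r-l-LW}})$ is a closed Riesz subalgebra and an order ideal of $(\mathrm{L}_r(E),\|\cdot\|_r)$.
   Context: Vector spaces are real and operators are linear. A sequence $(x_n)$ in a Banach lattice is disjoint if $|x_n|\wedge|x_m|=0$ for $n\neq m$. For a subset $L$ of a Banach lattice, $\mathrm{sol}(L)$ is its solid hull. A bounded subset $L$ of a Banach lattice $F$ is an LW-set (LW-subset) if every disjoint sequence in $\mathrm{sol}(L)$ is norm null. A bounded subset $A$ of a Banach space $X$ is limited if each weak$^*$-null sequence in $X'$ is uniformly null on $A$. An operator $T:X\to F$ from a Banach space to a Banach lattice is limitedly LW (l-LW) if it carries limited subsets of $X$ onto LW-subsets of $F$. $\text{l-LW}(E)$ is the set of l-LW-operators $E\to E$. An operator $T:E\to E$ is a regularly l-LW-operator, $T\in\text{r-l-LW}(E)$, if $T=T_1-T_2$ with $T_1,T_2$ positive l-LW-operators. $\mathrm{L}_r(E)$ is the space of regular operators on $E$ (differences of two positive operators), with composition as multiplication, the order $S\le T$ iff $T-S$ is positive, and the regular norm $\|T\|_r=\inf\{\|S\|:\pm T\le S\}$ (equal to $\|\,|T|\,\|$ when $E$ is Dedekind complete). The norm on $\text{r-l-LW}(E)$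 is $\|T\|_{\text{r-l-LW}}=\inf\{\|S\|:\pm T\le S\in\text{l-LW}(E)\}$. A Riesz subalgebra is a subalgebra that is also a vector sublattice. *)

(* Defs.v *)
From HB Require Import structures.
From mathcomp Require Import all_boot all_order all_algebra.
From mathcomp Require Import all_classical all_reals all_analysis.

Set Implicit Arguments.
Unset Strict Implicit.
Unset Printing Implicit Defensive.

Import Order.TTheory GRing.Theory Num.Theory.
Import numFieldNormedType.Exports.

Local Open Scope classical_set_scope.
Local Open Scope ring_scope.

(* The order is carried by the mixin itself and exported as an
   [Order.Lattice] instance below: a structure inheriting from both
   [CompleteNormedModule] and [Order.Lattice] is rejected by HB, because
   [Num.RealDomain] already joins [Order.Lattice] with the algebraic hierarchy. *)
HB.mixin Record CompleteNormedModule_isBanachLattice (R : realType) E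
    & CompleteNormedModule R E := {
  ble : rel E ;
  bmeet : E -> E -> E ;
  bjoin : E -> E -> E ;
  ble_refl : reflexive ble ;
  ble_anti : antisymmetric ble ;
  ble_trans : transitive ble ;
  ble_meet : forall x y z : E, ble x (bmeet y z) = ble x y && ble x z ;
  bjoin_le : forall x y z : E, ble (bjoin x y) z = ble x z && ble y z ;
  ble_add2r : forall x y z : E, ble x y -> ble (x + z) (y + z) ;
  ble_scale : forall (a : R) (x : E), 0 <= a -> ble 0 x -> ble 0 (a *: x) ;
  (* [bjoin x (- x)] is the modulus of [x]. *)
  ble_norm : forall x y : E,
    ble (bjoin x (- x)) (bjoin y (- y)) -> `|x| <= `|y|
}.

#[short(type="banachLatticeType")]
HB.structure Definition BanachLattice (R : realType) :=
  {E of CompleteNormedModule R E & CompleteNormedModule_isBanachLattice R E}.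

HB.instance Definition _ (R : realType) (E : banachLatticeType R) :=
  Order.Le_isPOrder.Build ring_display (BanachLattice.sort E)
    (@ble_refl R E) (@ble_anti R E) (@ble_trans R E).

HB.instance Definition _ (R : realType) (E : banachLatticeType R) :=
  Order.POrder_MeetJoin_isLattice.Build ring_display (BanachLattice.sort E)
    (@ble_meet R E) (@bjoin_le R E).

Section BanachLatticeSets.
Context {R : realType}.

Definition babs {E : banachLatticeType R} (x : E) : E := Order.join x (- x).

Definition disjoint_seq {E : banachLatticeType R} (u : nat -> E) : Prop :=
  forall n m, n != m -> Order.meet (babs (u n)) (babs (u m)) = 0.

Definition solid_hull {E : banachLatticeType R} (L : set E) : set E :=
  [set y | exists2 x, L x & babs y <= babs x].

Definition LW_set {E : banachLatticeType R} (L : set E) : Prop :=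
  bounded_set L /\
  forall u : nat -> E, (forall n, solid_hull L (u n)) -> disjoint_seq u ->
    u @ \oo --> (0 : E).

Definition limited_set {X : completeNormedModType R} (A : set X) : Prop :=
  bounded_set A /\
  forall f : nat -> {linear X -> R^o}, (forall n, continuous (f n)) ->
    (forall x, (fun n => f n x) @ \oo --> (0 : R^o)) ->
    {uniform A, (fun n => (f n : X -> R^o)) @ \oo --> (cst 0 : X -> R^o)}.

Definition lLW {X : completeNormedModType R} {F : banachLatticeType R} :
    set (X -> F) :=
  [set T | linear T /\ forall A : set X, limited_set A -> LW_set (T @` A)].

Definition dedekind_complete (E : banachLatticeType R) : Prop :=
  forall A : set E, has_sup A -> supremums A !=set0.

End BanachLatticeSets.

Section Operators.
Context {R : realType} {E : banachLatticeType R}.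
Implicit Types (S T U : E -> E) (A B : set (E -> E)).

Definition positive_op T : Prop :=
  linear T /\ forall x : E, 0 <= x -> 0 <= T x.

Definition op_le S T : Prop := positive_op (T \- S).

Definition regular_op : set (E -> E) :=
  [set T | exists T1 T2,
    [/\ positive_op T1, positive_op T2 & T = T1 \- T2]].

Definition rlLW : set (E -> E) :=
  [set T | exists T1 T2,
    [/\ positive_op T1 /\ lLW T1, positive_op T2 /\ lLW T2 & T = T1 \- T2]].

Definition opnorm T : R := sup [set `|T x| | x in [set x : E | `|x| <= 1]].

Definition dominators T : set (E -> E) :=
  [set S | [/\ linear S, op_le T S & op_le (\- T) S]].

Definition regular_norm T : R := inf [set opnorm S | S in dominators T].

Definition rlLW_norm T : R := inf [set opnorm S | S in dominators T `&` lLW].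

Definition linear_subspace A B : Prop :=
  [/\ A `<=` B, A (cst 0),
      (forall S T, A S -> A T -> A (S \+ T)) &
      (forall (a : R) T, A T -> A (a \*: T))].

(* Not required to contain the identity operator. *)
Definition subalgebra A B : Prop :=
  linear_subspace A B /\ forall S T, A S -> A T -> A (S \o T).

(* [U] is the supremum of [S] and [T] in the ordered space [B]. *)
Definition is_join B S T U : Prop :=
  [/\ B U, op_le S U, op_le T U &
      forall V, B V -> op_le S V -> op_le T V -> op_le U V].

(* Infima are then available too, as [S /\ T = - (- S \/ - T)]. *)
Definition vector_lattice B : Prop :=
  forall S T, B S -> B T -> exists U, is_join B S T U.

Definition vector_sublattice A B : Prop :=
  [/\ vector_lattice B, linear_subspace A B &
      forall S T U, A S -> A T -> is_join B S T U -> A U].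

Definition riesz_subalgebra A B : Prop :=
  subalgebra A B /\ vector_sublattice A B.

(* [SS] and [TT] are the moduli of [S] and [T] in the vector lattice [B]. *)
Definition order_ideal A B : Prop :=
  [/\ vector_lattice B, linear_subspace A B &
      forall S T SS TT, B S -> A T ->
        is_join B S (\- S) SS -> is_join B T (\- T) TT -> op_le SS TT -> A S].

Definition closed_in_norm (N : (E -> E) -> R) A B : Prop :=
  forall T, B T -> (forall e : R, 0 < e -> exists2 S, A S & N (T \- S) < e) ->
    A T.

End Operators.

Arguments regular_op {R} E.
Arguments rlLW {R} E.

(* Main.v *)
Require Import Defs.
From HB Require Import structures.
From mathcomp Require Import all_boot all_order all_algebra.
From mathcomp Require Import all_classical all_reals all_analysis.

Set Implicit Arguments.
Unset Strict Implicit.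
Unset Printing Implicit Defensive.

Import Order.TTheory GRing.Theory Num.Theory.
Import numFieldNormedType.Exports.

Local Open Scope classical_set_scope.
Local Open Scope ring_scope.

(** Everything rests on one reformulation of the limitedly LW property. Let
   [order_cont_part F] be the set of those [y] in [F] for which every disjoint
   sequence in the order interval from [- babs y] to [babs y] is norm null.
   It is a closed ideal of [F]. A continuous operator [T : X -> F] is limitedly
   LW if and only if its range lies in [order_cont_part F] ([lLW_range],
   [range_lLW]). One direction holds because singletons are limited. For the
   other, let [u] be a disjoint sequence in the solid hull of [T @` A], with
   [babs (u n) <= babs (T (a n))]. The functional
   [z |-> sup_k `|babs z /\ k *: babs (u n)|], where [/\] is the lattice meet,
   is a seminorm below the norm, so by Hahn--Banach it dominates a linear
   functional [h n] whose value at [T (a n)] is at least [`|u n|]. Since [u] is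
   disjoint and [T x] is in the order continuous part, [h n (T x)] tends to [0]
   for each [x]; that is, the functionals [h n \o T] are weak*-null. They are
   therefore uniformly null on the limited set [A], which forces [`|u n|] to
   tend to [0].

   Consequently limitedly LW operators, among positive operators, are closed
   under sums, positive multiples, products with positive operators on the
   right, and passage to smaller positive operators ([positive_lLW_le]).
   Positive operators are automatically continuous
   ([positive_op_continuous]). So [T] is in [rlLW E] exactly when it is linear
   and [babs (T x) <= D x] on the positive cone for some limitedly LW operator
   [D] ([rlLWP]), just as [T] is regular when there is any such [D]
   ([regular_opP]). The subalgebra property and the criterion on the identity
   follow by manipulating dominators.

   When [E] is Dedekind complete, the Riesz--Kantorovich formula
   ([riesz_kantorovich]) provides the modulus of a regular operator, the least
   of its dominators. It is limitedly LW as soon as one dominator is, which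
   gives the equality of the two norms, the sublattice and the ideal
   properties. For closedness, if [T] is approximated by [S] in [rlLW E] in
   regular norm, the modulus of [T] is at most a limitedly LW dominator of [S]
   plus a dominator of [T - S] of small norm; hence its values are limits of
   elements of the order continuous part ([ocp_approx]). *)

(** * Elementary theory of Banach lattices *)

Section VectorLattice.
Context {R : realType} {E : banachLatticeType R}.
Implicit Types (x y z : E) (a : R).

Local Notation "x `&` y" := (Order.meet x y).
Local Notation "x `|` y" := (Order.join x y).

Lemma vleD2r z x y : (x + z <= y + z) = (x <= y).
Proof.
apply/idP/idP => [h|h]; last exact: (ble_add2r _ _ z h).
by have := ble_add2r _ _ (- z) h; rewrite !addrK.
Qed.

Lemma vleD2l z x y : (z + x <= z + y) = (x <= y).
Proof. by rewrite ![z + _]addrC vleD2r. Qed.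

Lemma vleD x y z t : x <= y -> z <= t -> x + z <= y + t.
Proof. by move=> xy zt; apply: (@le_trans _ _ (y + z)); rewrite ?vleD2r ?vleD2l. Qed.

Lemma vsub_ge0 x y : (0 <= y - x) = (x <= y).
Proof. by rewrite -(vleD2r x 0) subrK add0r. Qed.

Lemma vlerBrDr x y z : (x <= y - z) = (x + z <= y).
Proof. by rewrite -(vleD2r z x) subrK. Qed.

Lemma vlerBlDr x y z : (x - z <= y) = (x <= y + z).
Proof. by rewrite -(vleD2r z (x - z)) subrK. Qed.

Lemma vleN x y : (- x <= - y) = (y <= x).
Proof. by rewrite -(vsub_ge0 (- x)) opprK addrC vsub_ge0. Qed.

Lemma vaddr_ge0 x y : 0 <= x -> 0 <= y -> 0 <= x + y.
Proof. by move=> x0 y0; rewrite -[leLHS]addr0; apply: vleD. Qed.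

Lemma vscale_ge0 a x : 0 <= a -> 0 <= x -> 0 <= a *: x.
Proof. exact: ble_scale. Qed.

Lemma vscale_le a x y : 0 <= a -> x <= y -> a *: x <= a *: y.
Proof. by move=> a0 xy; rewrite -vsub_ge0 -scalerBr vscale_ge0 // vsub_ge0. Qed.

Lemma vscale_le2 a b x : a <= b -> 0 <= x -> a *: x <= b *: x.
Proof. by move=> ab x0; rewrite -vsub_ge0 -scalerBl vscale_ge0 // subr_ge0. Qed.

Lemma vscale_pos_le a x y : 0 < a -> (a *: x <= a *: y) = (x <= y).
Proof.
move=> a0; apply/idP/idP => [|]; last by apply: vscale_le; exact: ltW.
move=> /(@vscale_le a^-1 _ _); rewrite !scalerA mulVf ?gt_eqF// !scale1r.
by apply; rewrite invr_ge0 ltW.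
Qed.

Lemma vjoinD x y z : (x `|` y) + z = (x + z) `|` (y + z).
Proof.
apply/le_anti/andP; split; last by rewrite leUx !vleD2r leUl leUr.
by rewrite -vlerBrDr leUx !vlerBrDr leUl leUr.
Qed.

Lemma vscaleK a x : 0 < a -> a^-1 *: (a *: x) = x.
Proof. by move=> a0; rewrite scalerA mulVf ?gt_eqF// scale1r. Qed.

Lemma vscale_meet a x y : 0 < a -> a *: (x `&` y) = (a *: x) `&` (a *: y).
Proof.
move=> a0; have ai : 0 < a^-1 by rewrite invr_gt0.
apply/le_anti/andP; split; first by rewrite lexI !vscale_pos_le// leIl leIr.
rewrite -(@vscale_pos_le a^-1)// vscaleK// lexI -{2}(vscaleK x a0).
by rewrite -{3}(vscaleK y a0) !vscale_pos_le// leIl leIr.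
Qed.

Lemma vmeet_ge0 x y : 0 <= x -> 0 <= y -> 0 <= x `&` y.
Proof. by move=> x0 y0; rewrite lexI x0. Qed.

Lemma le_babs x : x <= babs x. Proof. exact: leUl. Qed.

Lemma leN_babs x : - x <= babs x. Proof. exact: leUr. Qed.

Lemma babs_le x y : (babs x <= y) = (x <= y) && (- x <= y).
Proof. exact: leUx. Qed.

Lemma double_ge0 x : (0 <= x + x) = (0 <= x).
Proof.
apply/idP/idP => h; last exact: vaddr_ge0.
have e : x + x = (2 : R) *: x by rewrite scaler_nat mulr2n.
by rewrite -(vscaleK x (ltr0Sn R 1)) -e vscale_ge0// invr_ge0.
Qed.

Lemma babs_ge0 x : 0 <= babs x.
Proof.
by rewrite -double_ge0 -(subrr x) vleD ?le_babs ?leN_babs.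
Qed.

Lemma babs_id x : 0 <= x -> babs x = x.
Proof.
move=> x0; apply/le_anti; rewrite le_babs andbT babs_le lexx /=.
by apply: (le_trans _ x0); rewrite -oppr0 vleN.
Qed.

Lemma babsN x : babs (- x) = babs x.
Proof. by rewrite /babs opprK joinC. Qed.

Lemma babs0 : babs (0 : E) = 0. Proof. by rewrite babs_id. Qed.

Lemma babsD x y : babs (x + y) <= babs x + babs y.
Proof. by rewrite babs_le opprD !vleD ?le_babs ?leN_babs. Qed.

Lemma babs_abs x : babs (babs x) = babs x.
Proof. by rewrite babs_id ?babs_ge0. Qed.

Lemma babsZ a x : babs (a *: x) = `|a| *: babs x.
Proof.
wlog a0 : a / 0 < a => [hw|].
  have [a0|a0|<-] := ltgtP 0 a; first exact: hw.
    by rewrite -babsN -scaleNr hw ?oppr_gt0// normrN.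
  by rewrite normr0 !scale0r babs0.
rewrite gtr0_norm//; apply/le_anti/andP; split.
  by rewrite babs_le -scalerN !vscale_pos_le// le_babs leN_babs.
have ai : 0 < a^-1 by rewrite invr_gt0.
rewrite -(@vscale_pos_le a^-1)// vscaleK// babs_le -{1}(vscaleK x a0).
by rewrite -{1}(vscaleK (- x) a0) !vscale_pos_le// scalerN le_babs leN_babs.
Qed.

Lemma norm_le x y : babs x <= babs y -> `|x| <= `|y|.
Proof. exact: ble_norm. Qed.

Lemma norm_ge0_le x y : 0 <= x -> x <= y -> `|x| <= `|y|.
Proof. by move=> x0 xy; apply: norm_le; rewrite !babs_id// (le_trans x0). Qed.

Lemma norm_babs x : `|babs x| = `|x|.
Proof. by apply/le_anti; rewrite !norm_le ?babs_abs. Qed.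

Lemma babs_eq0 x : babs x <= 0 -> x = 0.
Proof.
move=> h; apply/eqP; rewrite -normr_le0 -(normr0 E).
by apply: norm_le; rewrite babs0.
Qed.

(** Riesz decomposition: a vector [z >= 0] below [x + y] splits as [z `&` x],
   which is below [x], plus a remainder, which is below [y]. *)
Lemma riesz_remainder x y z : 0 <= y -> z <= x + y -> z - (z `&` x) <= y.
Proof.
move=> y0 zxy; rewrite vlerBlDr addrC -vlerBlDr lexI vlerBlDr vlerBlDr zxy andbT.
by rewrite -[leLHS]addr0 vleD2l.
Qed.

(** Truncation at [z] is subadditive: the part of the truncated sum that is
   left after removing its meet with [x] is a Riesz remainder, hence below
   [y]. *)
Lemma meet_leD x y z : 0 <= x -> 0 <= y -> 0 <= z ->
  (x + y) `&` z <= (x `&` z) + (y `&` z).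
Proof.
move=> x0 y0 z0; set w := (x + y) `&` z.
have w0 : 0 <= w by rewrite vmeet_ge0// vaddr_ge0.
rewrite -[w](subrK (w `&` x)) addrC vleD//.
  by rewrite lexI leIr (le_trans (leIl _ _))// leIr.
rewrite lexI riesz_remainder ?leIl//= (le_trans _ (leIr _ _ : w <= z))//.
by rewrite vlerBlDr -[leLHS]addr0 vleD2l vmeet_ge0.
Qed.

(** Both multiples are dominated by the same multiple [a + b + 1] of the
   original vectors. *)
Lemma disjoint_scale a b x y : 0 <= a -> 0 <= b -> 0 <= x -> 0 <= y ->
  x `&` y = 0 -> (a *: x) `&` (b *: y) = 0.
Proof.
move=> a0 b0 x0 y0 xy; apply/le_anti/andP; split; last first.
  by rewrite vmeet_ge0// vscale_ge0.
have ab : 0 < a + b + 1 by rewrite ltr_wpDl// addr_ge0.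
rewrite -(scaler0 _ (a + b + 1)) -xy vscale_meet// leI2//.
  by rewrite vscale_le2// -addrA lerDl addr_ge0.
by rewrite vscale_le2// -addrA addrCA lerDl addr_ge0.
Qed.

Definition pospart x := x `|` 0.

Lemma pospart_ge0 x : 0 <= pospart x. Proof. exact: leUr. Qed.

Lemma pospart_shift x : x + pospart (- x) = pospart x.
Proof. by rewrite addrC /pospart vjoinD addNr add0r joinC. Qed.

Lemma pospartB x : pospart x - pospart (- x) = x.
Proof.
by rewrite -pospart_shift addrK.
Qed.

Lemma pospartD_babs x : pospart x + pospart (- x) = babs x.
Proof.
rewrite -[RHS](join_l (babs_ge0 x)) {1}/pospart vjoinD add0r pospart_shift.
by rewrite /pospart joinACA joinxx.
Qed.


Lemma pospart_eq0 x : pospart x = 0 -> x <= 0.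
Proof. by move=> <-; exact: leUl. Qed.

(** The positive cone is closed: the positive part of [y - s] is at most
   [babs (u n - s)] for large [n], hence has norm zero. *)
Lemma le_cvg (u : nat -> E) y s : u @ \oo --> s ->
  (\forall n \near \oo, y <= u n) -> y <= s.
Proof.
move=> us yu; rewrite -[y](subrK s) -[leRHS]add0r vleD2r; apply: pospart_eq0.
apply/eqP; rewrite -normr_le0; apply/ler_addgt0Pl => e e0; rewrite addr0.
near \oo => n; apply: (@le_trans _ _ `|s - u n|); last first.
  by near: n; exact: cvgr_dist_le.
rewrite (distrC s); apply: norm_le; rewrite babs_id ?pospart_ge0// leUx babs_ge0 andbT.
by apply: le_trans (le_babs _); rewrite vleD2r; near: n.
Unshelve. all: end_near. Qed.

End VectorLattice.
(** * The Hahn--Banach theorem for sublinear functionals *)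

Section HahnBanach.
Context {R : realType} {V : lmodType R}.
Implicit Types (p q : V -> R) (x y : V).

Definition sublinear p :=
  (forall x y, p (x + y) <= p x + p y) /\
  (forall (a : R) x, 0 <= a -> p (a *: x) = a * p x).

Lemma homogeneous_le p : p 0 = 0 ->
  (forall (a : R) x, 0 < a -> p (a *: x) <= a * p x) ->
  forall (a : R) x, 0 <= a -> p (a *: x) = a * p x.
Proof.
move=> p0 ple a x; rewrite le_eqVlt => /predU1P[<-|a0].
  by rewrite scale0r mul0r.
apply/le_anti; rewrite ple//= -ler_pdivlMl//.
have := ple a^-1 (a *: x); rewrite invr_gt0 => /(_ a0).
by rewrite scalerA mulVf ?gt_eqF// scale1r.
Qed.

Lemma sublinear0 p : sublinear p -> p 0 = 0.
Proof. by case=> _ /(_ 0 0 (lexx _)); rewrite scale0r mul0r. Qed.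

Lemma sublinear_ge p x : sublinear p -> - p (- x) <= p x.
Proof.
by move=> ps; have := ps.1 x (- x); rewrite subrr sublinear0// -lerBlDr sub0r.
Qed.

(** The largest sublinear functional below [p] that takes the value [- p y] at
   [- y], i.e. that is linear on the line spanned by [y]. *)
Definition slide p y x : R :=
  inf [set p (x + t *: y) - t * p y | t in [set t : R | 0 <= t]].

Lemma slide_ge p y x (t : R) : sublinear p -> 0 <= t ->
  - p (- x) <= p (x + t *: y) - t * p y.
Proof.
move=> ps t0; rewrite lerBrDr addrC lerBlDr -(ps.2 t)//.
by have := ps.1 (x + t *: y) (- x); rewrite addrC addKr.
Qed.

Lemma slide_le p y x (t : R) : sublinear p -> 0 <= t ->
  slide p y x <= p (x + t *: y) - t * p y.
Proof.
move=> ps t0; apply: ge_inf; last by exists t.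
by exists (- p (- x)) => _ [s s0 <-]; exact: slide_ge.
Qed.

Lemma le_slide p y x m :
  (forall t : R, 0 <= t -> m <= p (x + t *: y) - t * p y) -> m <= slide p y x.
Proof.
move=> h; apply: lb_le_inf; first by exists (p (x + 0 *: y) - 0 * p y); exists 0 => /=.
by move=> _ [t t0 <-]; exact: h.
Qed.

Lemma slide_le_id p y x : sublinear p -> slide p y x <= p x.
Proof. by move=> /(@slide_le _ y x) /(_ (lexx 0)); rewrite scale0r mul0r addr0 subr0. Qed.

Lemma slide_dir p y x : sublinear p -> slide p y x <= p (x + y) - p y.
Proof. by move=> /(@slide_le _ y x) /(_ ler01); rewrite scale1r mul1r. Qed.

Lemma slide_sublinear p y : sublinear p -> sublinear (slide p y).
Proof.
move=> ps; split=> [x z|].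
  rewrite -lerBlDr; apply: le_slide => t t0; rewrite lerBlDr -lerBlDl.
  apply: le_slide => s s0; rewrite lerBlDl.
  apply: le_trans (slide_le _ _ ps (addr_ge0 t0 s0)) _.
  by rewrite scalerDl addrACA mulrDl opprD [leRHS]addrACA lerD2r ps.1.
apply: homogeneous_le => [|a x a0].
  apply/le_anti/andP; split.
    by rewrite -[leRHS](sublinear0 ps); exact: slide_le_id.
  apply: le_slide => t t0; have := slide_ge y 0 ps t0.
  by rewrite oppr0 (sublinear0 ps) oppr0.
rewrite -ler_pdivrMl//; apply: le_slide => t t0; rewrite ler_pdivrMl//.
apply: le_trans (slide_le _ _ ps (mulr_ge0 (ltW a0) t0)) _.
by rewrite -scalerA -scalerDr ps.2 ?(ltW a0)// mulrBr mulrA.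
Qed.

(** The bound [- p (- x) <= q x] is common to all sublinear [q <= p], so the
   pointwise infimum is finite; subadditivity passes to it because any two
   members of the chain lie above one of them. *)
Lemma chain_inf_sublinear p (A : set (V -> R)) : A !=set0 ->
  (forall q, A q -> sublinear q /\ forall x, q x <= p x) ->
  (forall q q', A q -> A q' -> (forall x, q x <= q' x) \/ (forall x, q' x <= q x)) ->
  exists m, [/\ sublinear m, forall x, m x <= p x &
    forall q, A q -> forall x, m x <= q x].
Proof.
move=> [q0 Aq0] Ap Atot; pose m x := inf [set q x | q in A].
have mle q x : A q -> m x <= q x.
  move=> Aq; apply: ge_inf; last by exists q.
  exists (- p (- x)) => _ [r /Ap[rs rp] <-].
  by rewrite (le_trans _ (sublinear_ge x rs))// lerN2.
have le_m x c : (forall q, A q -> c <= q x) -> c <= m x.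
  move=> h; apply: lb_le_inf; first by exists (q0 x), q0.
  by move=> _ [q /h cq <-].
exists m; split=> [|x|q Aq x]; last exact: mle.
- split=> [x y|].
    rewrite -lerBlDr; apply: (le_m) => q Aq; rewrite lerBlDr -lerBlDl.
    apply: (le_m) => r Ar; rewrite lerBlDl.
    have [qr|rq] := Atot _ _ Aq Ar.
      apply: le_trans (mle _ _ Aq) _; apply: le_trans ((Ap _ Aq).1.1 _ _) _.
      by rewrite lerD2l.
    apply: le_trans (mle _ _ Ar) _; apply: le_trans ((Ap _ Ar).1.1 _ _) _.
    by rewrite lerD2r.
  apply: homogeneous_le => [|a x a0].
    apply/le_anti/andP; split.
      by rewrite -(sublinear0 (Ap _ Aq0).1); exact: mle.
    by apply: (le_m) => q /Ap[/sublinear0 -> _].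
  rewrite -ler_pdivrMl//; apply: (le_m) => q Aq; rewrite ler_pdivrMl//.
  by rewrite -(Ap _ Aq).1.2 ?(ltW a0)//; exact: mle.
- by apply: le_trans (mle _ _ Aq0) _; exact: (Ap _ Aq0).2.
Qed.

Lemma minimal_sublinear p : sublinear p ->
  exists q, [/\ sublinear q, forall x, q x <= p x &
    forall r, sublinear r -> (forall x, r x <= q x) -> r = q].
Proof.
move=> ps; pose T := {q | sublinear q /\ forall x, q x <= p x}.
pose le' (s t : T) := `[< forall x, sval t x <= sval s x >].
have [||||[q [qs qp]] qmin] := @Zorn T le'.
- by move=> t; apply/asboolP.
- move=> r s t /asboolP rs /asboolP st; apply/asboolP => x.
  exact: le_trans (st x) (rs x).
- move=> [s sP] [t tP] /asboolP st /asboolP ts; apply: eq_exist.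
  by apply/funext => x; apply/le_anti; rewrite ts st.
- move=> A Atot; have [A0|A0] := pselect (A !=set0); last first.
    by exists (exist _ p (conj ps (fun x => lexx (p x)))) => s As; case: A0; exists s.
  have [|||m [ms mp mA]] := @chain_inf_sublinear p [set sval s | s in A].
  + by case: A0 => s As; exists (sval s), s.
  + by move=> _ [[q qP] _ <-].
  + move=> _ _ [s As <-] [t At <-].
    by case: (Atot _ _ As At) => /asboolP; [right|left].
  by exists (exist _ m (conj ms mp)) => s As; apply/asboolP => x; apply: mA; exists s.
exists q; split=> // r rs rq.
have rp x : r x <= p x by exact: le_trans (rq x) (qp x).
by have := qmin (exist _ r (conj rs rp)); rewrite /le' /= => /(_ (asboolT rq)) -[].
Qed.

(** Hahn--Banach. A minimal sublinear functional coincides with its slides in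
   every direction, hence is additive; starting from a slide along [v] forces
   the value at [v]. *)
Lemma hahn_banach p v : sublinear p ->
  exists f : V -> R, [/\ forall (a : R) x y, f (a *: x + y) = a * f x + f y,
    forall x, f x <= p x & f v = p v].
Proof.
move=> ps; have [f [fs fp fmin]] := minimal_sublinear (slide_sublinear v ps).
have fD x y : f (x + y) = f x + f y.
  apply/le_anti; rewrite fs.1 /= -lerBrDr.
  have e : slide f y = f.
    by apply: fmin => [|z]; [exact: slide_sublinear|exact: slide_le_id].
  by rewrite -{1}e; exact: slide_dir.
have fN x : f (- x) = - f x.
  by apply/eqP; rewrite -addr_eq0 -fD addNr sublinear0.
exists f; split=> [a x y|x|].
- rewrite fD; congr (_ + _); have [a0|a0] := leP 0 a; first exact: fs.2.
  by rewrite -[a]opprK scaleNr fN fs.2 ?mulNr// oppr_ge0 ltW.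
- exact: le_trans (fp x) (slide_le_id _ _ ps).
apply/le_anti; rewrite (le_trans (fp v) (slide_le_id _ _ ps))/=.
rewrite -lerN2 -fN; apply: le_trans (fp _) _.
apply: le_trans (slide_dir _ _ ps) _.
by rewrite addNr sublinear0// sub0r.
Qed.

End HahnBanach.
(** * Automatic continuity of positive operators *)

Section PositiveOperators.
Context {R : realType} {E : banachLatticeType R}.
Implicit Types (S T U V : E -> E) (x y : E).

Lemma linear_packed (V W : lmodType R) (T : V -> W) :
  linear T -> exists f : {linear V -> W}, T = f.
Proof.
move=> lT; pose m := GRing.isLinear.Build R V W *:%R T lT.
by exists (HB.pack_for {linear V -> W} T m).
Qed.

Lemma op_lin0 T : linear T -> T 0 = 0.
Proof. by move=> /linear_packed[f ->]; exact: linear0. Qed.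

Lemma op_linD T x y : linear T -> T (x + y) = T x + T y.
Proof. by move=> /linear_packed[f ->]; exact: linearD. Qed.

Lemma op_linB T x y : linear T -> T (x - y) = T x - T y.
Proof. by move=> /linear_packed[f ->]; exact: linearB. Qed.

Lemma op_linN T x : linear T -> T (- x) = - T x.
Proof. by move=> /linear_packed[f ->]; exact: linearN. Qed.

Lemma op_linZ T (a : R) x : linear T -> T (a *: x) = a *: T x.
Proof. by move=> /linear_packed[f ->]; exact: linearZ. Qed.

Lemma positive_op_le T x y : positive_op T -> x <= y -> T x <= T y.
Proof.
move=> [lT T0] xy; rewrite -vsub_ge0 -op_linB//; apply: T0.
by rewrite vsub_ge0.
Qed.

Lemma positive_op_babs T x : positive_op T -> babs (T x) <= T (babs x).
Proof.
move=> Tp; rewrite babs_le -(op_linN x Tp.1).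
by rewrite !positive_op_le// ?le_babs ?leN_babs.
Qed.

Lemma norm_positive_op_le T x y : positive_op T -> babs x <= y -> `|T x| <= `|T y|.
Proof.
move=> Tp xy; apply: norm_le; apply: le_trans (positive_op_babs x Tp) _.
by apply: le_trans (le_babs _); exact: positive_op_le.
Qed.

(** If [T] is unbounded, there are [y n >= 0] of norm at most [2 ^- n] whose
   images have norm at least [2 ^+ n]. The sum of the [y n] dominates each of
   them, so the norm of its image would exceed every [2 ^+ n]. *)
Lemma positive_op_bounded T : positive_op T ->
  exists2 M : R, 0 <= M & forall x, `|T x| <= M * `|x|.
Proof.
move=> Tp; apply: contrapT => unb.
have /choice[y yP] (n : nat) : exists y, [/\ 0 <= y, `|y| <= 2^-1 ^+ n &
    (2 : R) ^+ n <= `|T y|].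
  (* The factor 4 pays both for shrinking the vector to norm [2 ^- n] and for
     keeping its image above [2 ^+ n]. *)
  have [x xP] : exists x, (4 : R) ^+ n * `|x| < `|T x|.
    apply: contrapT => h; apply: unb; exists (4 ^+ n); first exact: exprn_ge0.
    by move=> x; rewrite leNgt; apply/negP => xP; apply: h; exists x.
  have x0 : 0 < `|x|.
    rewrite normr_gt0; apply: contraPneq xP => ->.
    by rewrite (op_lin0 Tp.1) !normr0 mulr0 ltxx.
  have c0 : 0 <= (2^-1 : R) ^+ n / `|x| by rewrite divr_ge0 ?exprn_ge0.
  exists ((2^-1 ^+ n / `|x|) *: babs x); split.
  - by rewrite vscale_ge0// babs_ge0.
  - by rewrite normrZ norm_babs ger0_norm// divfK// gt_eqF.
  - rewrite (op_linZ _ _ Tp.1) normrZ ger0_norm//.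
    apply: (@le_trans _ _ (2^-1 ^+ n / `|x| * (4 ^+ n * `|x|))).
      rewrite mulrCA -mulrA mulVf ?gt_eqF// mulr1 -exprMn.
      by rewrite (_ : 4 / 2 = 2)// (natrM _ 2 2) mulfK.
    rewrite ler_wpM2l//; apply: le_trans (ltW xP) _.
    by apply: norm_positive_op_le.
have cvgy : cvgn (series y).
  apply: normed_cvg; apply: (@series_le_cvg _ _ (geometric 1 2^-1)) => [n|n|n|].
  - exact: normr_ge0.
  - by rewrite /geometric /= mul1r exprn_ge0.
  - by rewrite /geometric /= mul1r; case: (yP n).
  - by apply: is_cvg_geometric_series; rewrite ger0_norm// invf_lt1// ltr1n.
have yS n : y n <= limn (series y).
  apply: (le_cvg cvgy); exists n.+1 => // k /= /subnK <-.
  elim: (k - n.+1)%N => [|i IH].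
    rewrite add0n seriesSr -[leLHS]add0r vleD2r.
    elim: n => [|n IH]; first by rewrite /series /= big_geq.
    by rewrite seriesSr vaddr_ge0//; case: (yP n).
  rewrite addSn seriesSr -[leLHS]addr0 vleD//; by case: (yP (i + n.+1)%N).
have TS n : (2 : R) ^+ n <= `|T (limn (series y))|.
  have [y0 _ /le_trans] := yP n; apply; apply: norm_positive_op_le => //.
  by rewrite babs_id.
have := archi_boundP (normr_ge0 (T (limn (series y)))).
set N := Num.Def.archi_bound _ => /lt_le_trans.
move=> /(_ _ (le_trans _ (TS N))); rewrite ltxx => h; suff: false by [].
by apply: h; rewrite -natrX ler_nat ltnW// ltn_expl.
Qed.

Lemma positive_op_continuous T : positive_op T -> continuous T.
Proof.
move=> Tp; have [M M0 TM] := positive_op_bounded Tp.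
move: TM; have [f ->] := linear_packed Tp.1 => TM.
apply/bounded_linear_continuous/linear_boundedP.
exists M; split=> [|r /ltW Mr x]; first exact: num_real.
by apply: le_trans (TM x) _; rewrite ler_wpM2r.
Qed.
End PositiveOperators.
(** * The order continuous part *)

Lemma norm_le_bounded_set (R : realType) (V : normedModType R) (A : set V) (M : R) :
  (forall x, A x -> `|x| <= M) -> bounded_set A.
Proof.
by move=> AM; exists M; split=> [|r /ltW Mr x /AM /le_trans]; [exact: num_real|apply].
Qed.

Lemma near_norm_le (R : realType) (V : normedModType R) (u : nat -> V) (e : R) :
  u @ \oo --> (0 : V) -> 0 < e -> \forall n \near \oo, `|u n| <= e.
Proof. by move=> u0 e0; exact: cvgr0_norm_le. Qed.

Section OrderContinuousPart.
Context {R : realType} {E : banachLatticeType R}.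
Implicit Types (x y z d w : E) (u v : nat -> E).

Local Notation "x `&` y" := (Order.meet x y).

Definition order_cont_part : set E :=
  [set y | forall u, (forall n, babs (u n) <= babs y) -> disjoint_seq u ->
    u @ \oo --> (0 : E)].

Lemma disjoint_le u v : disjoint_seq u ->
  (forall n, babs (v n) <= babs (u n)) -> disjoint_seq v.
Proof.
move=> du vu n m nm; apply/le_anti; rewrite vmeet_ge0 ?babs_ge0// andbT.
by rewrite -(du n m nm) leI2.
Qed.

Lemma disjointZ u (a : nat -> R) : disjoint_seq u ->
  disjoint_seq (fun n => a n *: u n).
Proof.
move=> du n m nm; rewrite !babsZ disjoint_scale ?babs_ge0//.
exact: du.
Qed.

Lemma ocp_le y z : babs z <= babs y -> order_cont_part y -> order_cont_part z.
Proof. by move=> zy oy u uz; apply: oy => n; exact: le_trans (uz n) zy. Qed.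

(** A disjoint sequence stays disjoint after truncation by [z]. *)
Lemma ocp_truncate z u : order_cont_part z -> disjoint_seq u ->
  (fun n => babs z `&` babs (u n)) @ \oo --> (0 : E).
Proof.
move=> oz du; have m0 n : 0 <= babs z `&` babs (u n) by rewrite vmeet_ge0 ?babs_ge0.
apply: oz => [n|]; first by rewrite babs_id ?leIl.
by apply: disjoint_le du _ => n; rewrite babs_id// leIr.
Qed.

Lemma norm_le_truncD x y z : babs x <= babs y + babs z ->
  `|x| <= `|babs y `&` babs x| + `|babs z `&` babs x|.
Proof.
move=> xyz; apply: le_trans (ler_normD _ _).
rewrite -norm_babs norm_ge0_le ?babs_ge0//.
apply: le_trans (meet_leD _ _ _); rewrite ?babs_ge0//.
by rewrite lexI xyz lexx.
Qed.

Lemma ocp0 : order_cont_part 0.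
Proof.
move=> u u0 _; have -> : u = cst 0; last exact: cvg_cst.
by apply/funext => n; apply: babs_eq0; rewrite -babs0.
Qed.

(** A vector below [babs (y + z)] is at most the sum of its truncations by
   [babs y] and [babs z], and both truncations of a disjoint sequence are
   null. *)
Lemma ocpD y z : order_cont_part y -> order_cont_part z -> order_cont_part (y + z).
Proof.
move=> oy oz u uyz du; apply/cvgr0Pnorm_le => e e0.
have e2 : 0 < e / 2 by rewrite divr_gt0.
have := near_norm_le (ocp_truncate oy du) e2.
have := near_norm_le (ocp_truncate oz du) e2.
apply: filterS2 => n nz ny; rewrite [leRHS]splitr.
apply: le_trans (norm_le_truncD (le_trans (uyz n) (babsD _ _))) _.
exact: lerD.
Qed.

Lemma ocpZ (a : R) y : order_cont_part y -> order_cont_part (a *: y).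
Proof.
move=> oy; have [->|a0] := eqVneq a 0.
  by apply: ocp_le oy; rewrite scale0r babs0 babs_ge0.
move=> u uy du; apply/cvgr0Pnorm_le => e e0.
have na : 0 < `|a| by rewrite normr_gt0.
have /near_norm_le : (fun n => a^-1 *: u n) @ \oo --> (0 : E); last first.
  move=> /(_ _ (divr_gt0 e0 na)); apply: filterS => n.
  by rewrite normrZ normfV ler_pdivlMr// mulrAC mulVf ?mul1r// gt_eqF.
apply: oy; last exact: (disjointZ (fun=> a^-1)).
move=> n; rewrite babsZ -(@vscale_pos_le _ _ `|a|) ?normr_gt0//.
by rewrite scalerA -normrM mulfV// normr1 scale1r -babsZ.
Qed.

Lemma ocpB y z : order_cont_part y -> order_cont_part z -> order_cont_part (y - z).
Proof. by move=> oy oz; apply: ocpD => //; rewrite -scaleN1r; exact: ocpZ. Qed.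

(** The order continuous part is norm closed; the approximation is one-sided
   and by domination, which is the form in which operators provide it. *)
Lemma ocp_approx y : (forall e : R, 0 < e -> exists z d,
    [/\ order_cont_part z, `|d| <= e & babs y <= babs z + babs d]) ->
  order_cont_part y.
Proof.
move=> yzd u uy du; apply/cvgr0Pnorm_le => e e0.
have e2 : 0 < e / 2 by rewrite divr_gt0.
have [z [d [oz de yz]]] := yzd _ e2.
have := near_norm_le (ocp_truncate oz du) e2.
apply: filterS => n nz; rewrite [leRHS]splitr.
apply: le_trans (norm_le_truncD (le_trans (uy n) yz)) _.
apply: lerD => //; apply: le_trans de; rewrite -[leRHS]norm_babs.
by rewrite norm_ge0_le ?vmeet_ge0 ?babs_ge0 ?leIl.
Qed.

(** A substitute, with no order completeness, for the norm of the component of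
   [z] in the band generated by [w]: that component is approached from below
   by the elements [babs z `&` (k *: babs w)]. *)
Definition carrier_norm w z : R :=
  sup [set `|babs z `&` (k *: babs w)| | k in [set k : R | 0 <= k]].

Lemma meet_carrier_ge0 w z (k : R) : 0 <= k -> 0 <= babs z `&` (k *: babs w).
Proof. by move=> k0; rewrite vmeet_ge0 ?vscale_ge0 ?babs_ge0. Qed.

Lemma carrier_has_sup w z :
  has_sup [set `|babs z `&` (k *: babs w)| | k in [set k : R | 0 <= k]].
Proof.
split; first by exists `|babs z `&` (0 *: babs w)|; exists 0 => /=.
exists `|z| => _ [k /= k0 <-]; rewrite -[leRHS]norm_babs.
by rewrite norm_ge0_le ?leIl// meet_carrier_ge0.
Qed.

Lemma carrier_norm_ub w z (k : R) : 0 <= k ->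
  `|babs z `&` (k *: babs w)| <= carrier_norm w z.
Proof. by move=> k0; apply: ub_le_sup; [exact: (carrier_has_sup w z).2|exists k]. Qed.

Lemma carrier_norm_le w z (m : R) :
  (forall k : R, 0 <= k -> `|babs z `&` (k *: babs w)| <= m) ->
  carrier_norm w z <= m.
Proof.
move=> h; apply: ge_sup; first exact: (carrier_has_sup w z).1.
by move=> _ [k /= k0 <-]; exact: h.
Qed.

Lemma carrier_norm_le_norm w z : carrier_norm w z <= `|z|.
Proof.
apply: carrier_norm_le => k k0; rewrite -[leRHS]norm_babs.
by rewrite norm_ge0_le ?leIl// meet_carrier_ge0.
Qed.

Lemma carrier_normN w z : carrier_norm w (- z) = carrier_norm w z.
Proof. by rewrite /carrier_norm babsN. Qed.

Lemma carrier_norm_sublinear w : sublinear (carrier_norm w).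
Proof.
split=> [x y|].
  apply: carrier_norm_le => k k0.
  apply: le_trans (lerD (carrier_norm_ub w x k0) (carrier_norm_ub w y k0)).
  apply: le_trans (ler_normD _ _); rewrite norm_ge0_le ?meet_carrier_ge0//.
  apply: le_trans (meet_leD _ _ _); rewrite ?vscale_ge0 ?babs_ge0//.
  by rewrite leI2// babsD.
apply: homogeneous_le => [|a x a0].
  apply/le_anti; rewrite -{1}(normr0 E) carrier_norm_le_norm/=.
  exact: le_trans (carrier_norm_ub w 0 (lexx _)).
apply: carrier_norm_le => k k0; rewrite babsZ gtr0_norm//.
have -> : k *: babs w = a *: ((k / a) *: babs w).
  by rewrite scalerA mulrCA mulfV ?mulr1// gt_eqF.
rewrite -vscale_meet// normrZ gtr0_norm// ler_wpM2l ?(ltW a0)//.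
by apply: carrier_norm_ub; rewrite divr_ge0// ltW.
Qed.

(** Near-optimal truncations of [y] along a disjoint sequence again form a
   disjoint sequence in the solid hull of [y]. *)
Lemma carrier_norm_ocp_cvg0 y u : order_cont_part y -> disjoint_seq u ->
  (fun n => carrier_norm (u n) y) @ \oo --> (0 : R^o).
Proof.
move=> oy du; apply/cvgr0Pnorm_le => e e0.
have e2 : 0 < e / 2 by rewrite divr_gt0.
have /choice[k kP] n : exists k : R, 0 <= k /\
    carrier_norm (u n) y - e / 2 < `|babs y `&` (k *: babs (u n))|.
  by have [_ [k k0 <-] h] := sup_adherent e2 (carrier_has_sup (u n) y); exists k.
have kE n : k n *: babs (u n) = babs (k n *: u n).
  by rewrite babsZ ger0_norm//; case: (kP n).
have := near_norm_le (ocp_truncate oy (disjointZ k du)) e2.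
apply: filterS => n; rewrite -kE => tn.
rewrite ger0_norm; last exact: le_trans (carrier_norm_ub (u n) y (lexx 0)).
rewrite [leRHS]splitr -lerBlDr; apply: le_trans (ltW (kP n).2) tn.
Qed.

End OrderContinuousPart.
Arguments order_cont_part {R} E.

(** * Limitedly LW operators are those with range in the order continuous part *)

Section LimitedlyLW.
Context {R : realType} {X : completeNormedModType R} {F : banachLatticeType R}.
Implicit Types (T : X -> F).

Lemma limited_set1 (x : X) : limited_set [set x].
Proof.
split; first by apply: (@norm_le_bounded_set _ _ _ `|x|) => _ ->.
move=> f cf fx P /= /uniform_nbhs[U [entU UP]].
have : \forall n \near \oo, U (0, f n x).
  have : \forall n \near \oo, xsection U 0 (f n x).
    exact: (fx x _ (nbhs_entourage _ entU)).
  by apply: filterS => n /=; rewrite /xsection /= inE.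
by apply: filterS => n Un; apply: UP => _ ->.
Qed.

(** Singletons are limited. *)
Lemma lLW_range T : lLW T -> forall x, order_cont_part F (T x).
Proof.
move=> [_ TLW] x u ux; have [_ +] := TLW _ (limited_set1 x); apply => n.
by exists (T x); [exists x|exact: ux].
Qed.

(** The functional [h n] below is supported on the carrier of [u n], so the
   disjointness of [u] makes the sequence [h n \o T] weak*-null, while
   [h n (T (a n)) >= `|u n|] turns uniform convergence on [A] into
   convergence of [u]. *)
Lemma range_lLW T : linear T -> continuous T ->
  (forall x, order_cont_part F (T x)) -> lLW T.
Proof.
move=> lT cT oT; split=> // A [bA Alim].
have [M M0 TM] : exists2 M : R, 0 < M & forall x, `|T x| <= M * `|x|.
  move: lT cT => /linear_packed[g ->] /linear_bounded_continuous.
  by move=> /linear_boundedP /pinfty_ex_gt0[M M0 gM]; exists M.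
split.
  have /pinfty_ex_gt0[N N0 AN] := bA.
  apply: (@norm_le_bounded_set _ _ _ (M * N)) => _ [x Ax <-]; apply: le_trans (TM x) _.
  by rewrite ler_pM2l//; exact: AN.
move=> u uA du.
have /choice[a aP] n : exists a, A a /\ babs (u n) <= babs (T a).
  by have [_ [a Aa <-] ua] := uA n; exists a.
have /choice[h hP] n := hahn_banach (T (a n)) (carrier_norm_sublinear (u n)).
have hle n y : `|h n y| <= carrier_norm (u n) y.
  have [hl hc _] := hP n; rewrite ler_norml hc andbT lerNl.
  rewrite -carrier_normN; apply: le_trans (hc _).
  suff -> : h n (- y) = - h n y by [].
  by have [g ->] := @linear_packed _ _ _ (h n : F -> R^o) hl; rewrite linearN.
have /choice[f fP] n : exists f : {linear X -> R^o}, f = h n \o T :> (X -> R^o).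
  have [hl _ _] := hP n.
  suff : linear (h n \o T : X -> R^o) by move=> /linear_packed[f ->]; exists f.
  by move=> b x y /=; rewrite lT hl.
have cf n : continuous (f n).
  apply/bounded_linear_continuous/linear_boundedP.
  exists M; split=> [|r /ltW Mr x]; first exact: num_real.
  rewrite fP; apply: le_trans (hle _ _) _; apply: le_trans (carrier_norm_le_norm _ _) _.
  by apply: le_trans (TM x) _; rewrite ler_wpM2r.
have f0 x : (fun n => f n x) @ \oo --> (0 : R^o).
  apply/cvgr0Pnorm_le => e e0.
  have := near_norm_le (carrier_norm_ocp_cvg0 (oT x) du) e0.
  apply: filterS => n; rewrite fP; apply: le_trans.
  by apply: le_trans (hle _ _) _; exact: ler_norm.
apply/cvgr0Pnorm_lt => e e0.
have nP : nbhs (cst 0 : {uniform` A -> R^o})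
    [set g : X -> R^o | forall y, A y -> `|g y| < e].
  apply/uniform_nbhs; exists [set q | ball q.1 e q.2]; split.
    exact: (entourage_ball R^o (PosNum e0)).
  by move=> g /= gA y /gA; rewrite -ball_normE /ball_ /= sub0r normrN.
have : \forall n \near \oo, forall y, A y -> `|f n y| < e.
  exact: (Alim f cf f0 _ nP).
apply: filterS => n fn.
have [Aa ua] := aP n; apply: le_lt_trans (fn _ Aa); rewrite fP /=.
have [_ _ ->] := hP n; apply: le_trans (ler_norm _).
apply: le_trans (carrier_norm_ub (u n) (T (a n)) ler01).
by rewrite scale1r (elimT meet_idPr) ?norm_babs.
Qed.

End LimitedlyLW.
Arguments lLW_range {R X F T} _ x.
(** * Dominators, and regularly limitedly LW operators *)

Section OperatorOrder.
Context {R : realType} {E : banachLatticeType R}.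
Implicit Types (S T U V D P : E -> E) (x y : E).

Lemma op_lin_cst0 : linear (cst 0 : E -> E).
Proof. by move=> a x y; rewrite scaler0 addr0. Qed.

Lemma op_lin_add S T : linear S -> linear T -> linear (S \+ T).
Proof. by move=> lS lT a x y /=; rewrite lS lT scalerDr addrACA. Qed.

Lemma op_lin_sub S T : linear S -> linear T -> linear (S \- T).
Proof. by move=> lS lT a x y /=; rewrite lS lT scalerBr opprD addrACA. Qed.

Lemma op_lin_opp T : linear T -> linear (\- T).
Proof. by move=> lT a x y /=; rewrite lT opprD scalerN. Qed.

Lemma op_lin_scale (c : R) T : linear T -> linear (c \*: T).
Proof. by move=> lT a x y /=; rewrite lT scalerDr !scalerA mulrC. Qed.

Lemma op_lin_comp S T : linear S -> linear T -> linear (S \o T).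
Proof. by move=> lS lT a x y /=; rewrite lT lS. Qed.

Lemma op_le_pt S T x : op_le S T -> 0 <= x -> S x <= T x.
Proof. by move=> [_ h] /h; rewrite /= vsub_ge0. Qed.

Lemma op_leP S T : linear S -> linear T ->
  op_le S T <-> forall x, 0 <= x -> S x <= T x.
Proof.
move=> lS lT; split=> [h x|h]; first exact: op_le_pt.
by split=> [|x /h]; [exact: op_lin_sub|rewrite /= vsub_ge0].
Qed.

Lemma op_le_trans S T U : op_le S T -> op_le T U -> op_le S U.
Proof.
move=> [lST ST] [lTU TU]; rewrite /op_le.
have -> : U \- S = (U \- T) \+ (T \- S) by apply/funext => x /=; rewrite addrA subrK.
by split=> [|x x0]; [exact: op_lin_add|rewrite vaddr_ge0 ?ST ?TU].
Qed.

(** The cone spans [E], and the order continuous part is a subspace. *)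
Lemma range_ocp T : linear T ->
  (forall x, 0 <= x -> order_cont_part E (T x)) ->
  forall x, order_cont_part E (T x).
Proof.
move=> lT oT x; rewrite -(pospartB x) op_linB//.
by apply: ocpB; apply: oT; exact: pospart_ge0.
Qed.

Lemma positive_lLWP T : positive_op T ->
  lLW T <-> forall x, 0 <= x -> order_cont_part E (T x).
Proof.
move=> Tp; split=> [/lLW_range oT x _|oT]; first exact: oT.
by apply: range_lLW;
  [exact: Tp.1|exact: positive_op_continuous|exact: range_ocp Tp.1 oT].
Qed.

(** The values of [S] on the cone lie below those of [T], and the order
   continuous part is an ideal. *)
Lemma positive_lLW_le S T : positive_op S -> positive_op T ->
  (forall x, 0 <= x -> S x <= T x) -> lLW T -> lLW S.
Proof.
move=> Sp Tp ST /(positive_lLWP Tp) oT; apply/(positive_lLWP Sp) => x x0.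
apply: ocp_le (oT x x0); rewrite !babs_id ?ST//; [exact: Tp.2|exact: Sp.2].
Qed.

Lemma dominatorsP T D : linear T ->
  dominators T D <-> linear D /\ forall x, 0 <= x -> babs (T x) <= D x.
Proof.
move=> lT; have lNT := op_lin_opp lT; split=> [[lD TD NTD]|[lD TD]].
  split=> // x x0; rewrite babs_le (op_le_pt TD)//=.
  exact: (op_le_pt NTD x0).
split=> //; [apply/op_leP => // x x0|apply/op_leP => // x x0].
  exact: le_trans (le_babs _) (TD x x0).
exact: le_trans (leN_babs _) (TD x x0).
Qed.

Lemma dominators_positive T D : linear T -> dominators T D -> positive_op D.
Proof.
move=> lT /dominatorsP-/(_ lT)[lD TD]; split=> // x x0.
exact: le_trans (babs_ge0 _) (TD x x0).
Qed.

Lemma dominators_diff T1 T2 : positive_op T1 -> positive_op T2 ->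
  dominators (T1 \- T2) (T1 \+ T2).
Proof.
move=> [lT1 T1p] [lT2 T2p]; apply/dominatorsP; first exact: op_lin_sub.
split=> [|x x0]; first exact: op_lin_add.
by apply: le_trans (babsD _ _) _; rewrite babsN !babs_id/= ?T1p ?T2p.
Qed.

Lemma dominators_shift T D : linear T -> dominators T D ->
  positive_op (T \+ D) /\ forall x, 0 <= x -> (T \+ D) x <= (D \+ D) x.
Proof.
move=> lT /dominatorsP-/(_ lT)[lD TD]; split=> [|x x0 /=].
  split=> [|x x0 /=]; first exact: op_lin_add.
  rewrite addrC -[T x]opprK vsub_ge0.
  exact: le_trans (leN_babs _) (TD x x0).
by rewrite vleD2r; exact: le_trans (le_babs _) (TD x x0).
Qed.

Lemma regular_opP T :
  regular_op E T <-> linear T /\ exists D, dominators T D.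
Proof.
split=> [[T1 [T2 [T1p T2p ->]]]|[lT [D TD]]].
  split; first exact: op_lin_sub T1p.1 T2p.1.
  by exists (T1 \+ T2); exact: dominators_diff.
have [TDp _] := dominators_shift lT TD.
exists (T \+ D), D; split=> //; first exact: dominators_positive TD.
by apply/funext => x /=; rewrite addrK.
Qed.

(** With [D] a limitedly LW dominator, [T + D] is positive and below [D + D], so
   domination makes [(T + D) - D] a decomposition of the required kind. *)
Lemma rlLWP T :
  rlLW E T <-> linear T /\ exists D, dominators T D /\ lLW D.
Proof.
split=> [[T1 [T2 [[T1p T1l] [T2p T2l] ->]]]|[lT [D [TD lD]]]].
  split; first exact: op_lin_sub T1p.1 T2p.1.
  exists (T1 \+ T2); split; first exact: dominators_diff.
  have T12p := dominators_positive (op_lin_sub T1p.1 T2p.1) (dominators_diff T1p T2p).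
  apply/(positive_lLWP T12p) => x x0.
  by apply: ocpD; [exact: (lLW_range T1l)|exact: (lLW_range T2l)].
have Dp := dominators_positive lT TD.
have [TDp TD2] := dominators_shift lT TD.
exists (T \+ D), D; split=> //; last by apply/funext => x /=; rewrite addrK.
split=> //; apply/(positive_lLWP TDp) => x x0.
have Dx := lLW_range lD x.
apply: ocp_le (ocpD Dx Dx); rewrite !babs_id; first exact: TD2.
  by rewrite vaddr_ge0 ?Dp.2.
exact: TDp.2.
Qed.

Lemma rlLW_regular T : rlLW E T -> regular_op E T.
Proof. by move=> /rlLWP[lT [D [TD _]]]; apply/regular_opP; split=> //; exists D. Qed.

Lemma positive_regular T : positive_op T -> regular_op E T.
Proof.
move=> Tp; apply/regular_opP; split; first exact: Tp.1.
exists T; apply/dominatorsP; first exact: Tp.1.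
by split=> [|x x0]; [exact: Tp.1|rewrite babs_id// Tp.2].
Qed.

Lemma dominatorsD S T D D' : linear S -> linear T ->
  dominators S D -> dominators T D' -> dominators (S \+ T) (D \+ D').
Proof.
move=> lS lT /(dominatorsP _ lS)[lD SD] /(dominatorsP _ lT)[lD' TD'].
apply/dominatorsP; first exact: op_lin_add.
split=> [|x x0]; first exact: op_lin_add.
by apply: le_trans (babsD _ _) _; rewrite vleD ?SD ?TD'.
Qed.

Lemma dominatorsZ (a : R) T D : linear T ->
  dominators T D -> dominators (a \*: T) (`|a| \*: D).
Proof.
move=> lT /(dominatorsP _ lT)[lD TD].
apply/dominatorsP; first exact: op_lin_scale.
split=> [|x x0]; first exact: op_lin_scale.
by rewrite /= babsZ vscale_le// TD.
Qed.

(** A dominator [D] of [S] satisfies [babs (S y) <= D (babs y)] for every [y], as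
   one sees by splitting [y] into its positive and negative parts; this is
   applied to [y = T x]. *)
Lemma dominators_comp S T D D' : linear S -> linear T ->
  dominators S D -> dominators T D' -> dominators (S \o T) (D \o D').
Proof.
move=> lS lT SD TD'; have Dp := dominators_positive lS SD.
have Sbabs y : babs (S y) <= D (babs y).
  move: SD => /(dominatorsP _ lS)[_ SD].
  rewrite -{1}(pospartB y) op_linB//; apply: le_trans (babsD _ _) _.
  rewrite babsN; apply: le_trans (vleD (SD _ (pospart_ge0 _)) (SD _ (pospart_ge0 _))) _.
  by rewrite -op_linD ?pospartD_babs//; exact: Dp.1.
move: TD' => /(dominatorsP _ lT)[lD' TD'].
apply/dominatorsP; first exact: op_lin_comp.
split=> [|x x0]; first exact: op_lin_comp Dp.1 lD'.
by apply: le_trans (Sbabs _) _; apply: positive_op_le => //; exact: TD'.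
Qed.

Lemma rlLW_subalgebra : subalgebra (rlLW E) (regular_op E).
Proof.
split; first split.
- exact: rlLW_regular.
- apply/rlLWP; split; first exact: op_lin_cst0.
  have p0 : positive_op (cst 0 : E -> E) by split=> //; exact: op_lin_cst0.
  exists (cst 0); split.
    apply/dominatorsP; first exact: op_lin_cst0.
    by split=> [|x x0]; [exact: op_lin_cst0|rewrite babs0].
  by apply/(positive_lLWP p0) => x x0 u u0 du; apply: ocp0.
- move=> S T /rlLWP[lS [D [SD oD]]] /rlLWP[lT [D' [TD' oD']]].
  apply/rlLWP; split; first exact: op_lin_add.
  have DD := dominatorsD lS lT SD TD'.
  exists (D \+ D'); split=> //.
  apply/positive_lLWP; first exact: dominators_positive (op_lin_add lS lT) DD.
  by move=> x _; apply: ocpD; apply: lLW_range.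
- move=> a T /rlLWP[lT [D [TD oD]]].
  apply/rlLWP; split; first exact: op_lin_scale.
  have DD := dominatorsZ a lT TD.
  exists (`|a| \*: D); split=> //.
  apply/positive_lLWP; first exact: dominators_positive (op_lin_scale a lT) DD.
  by move=> x _; apply: ocpZ; apply: lLW_range.
move=> S T /rlLWP[lS [D [SD oD]]] /rlLWP[lT [D' [TD' oD']]].
apply/rlLWP; split; first exact: op_lin_comp.
have DD := dominators_comp lS lT SD TD'.
exists (D \o D'); split=> //.
apply/positive_lLWP; first exact: dominators_positive (op_lin_comp lS lT) DD.
by move=> x _; exact: (lLW_range oD).
Qed.

(** Either condition says that the order continuous part is all of [E]. *)
Lemma rlLW_eq_regular : rlLW E = regular_op E <-> lLW (@idfun E).
Proof.
have lid : linear (@idfun E) by [].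
split=> [rE|].
  apply: range_lLW => // [x|x]; first exact: cvg_id.
  have : rlLW E idfun.
    by rewrite rE; apply: positive_regular; split.
  move=> [T1 [T2 [[_ oT1] [_ oT2] idE]]].
  by rewrite idE /=; apply: ocpB; exact: lLW_range.
move=> /lLW_range oid; apply/seteqP; split=> [|T]; first exact: rlLW_regular.
move=> /regular_opP[lT [D TD]]; apply/rlLWP; split=> //; exists D; split=> //.
apply/positive_lLWP; first exact: dominators_positive TD.
by move=> x _; exact: oid.
Qed.

End OperatorOrder.
(** * The modulus of a regular operator on a Dedekind complete lattice *)

Section RieszKantorovich.
Context {R : realType} {E : banachLatticeType R}.
Implicit Types (S T U V D P : E -> E) (x y z : E).

Local Notation "x `&` y" := (Order.meet x y).

(** The extension maps [x - y], for [x] and [y] in the cone, to [f x - f y]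
   (the step [FB] below), whichever decomposition is chosen. *)
Lemma cone_extension (f : E -> E) :
  (forall x y, 0 <= x -> 0 <= y -> f (x + y) = f x + f y) ->
  (forall (a : R) x, 0 <= a -> 0 <= x -> f (a *: x) = a *: f x) ->
  exists2 F : E -> E, linear F & forall x, 0 <= x -> F x = f x.
Proof.
move=> fD fZ; pose F x := f (pospart x) - f (pospart (- x)).
have FB x y : 0 <= x -> 0 <= y -> F (x - y) = f x - f y.
  move=> x0 y0; apply/eqP; rewrite subr_eq addrAC eq_sym subr_eq.
  have px := pospart_ge0 (x - y); have py := pospart_ge0 (- (x - y)).
  rewrite -!fD//; apply/eqP; congr (f _).
  by rewrite -(pospart_shift (x - y)) [RHS]addrAC subrK.
exists F => [a x y|x x0]; last first.
  have f0 : f 0 = 0 by have := fZ 0 0 (lexx _) (lexx _); rewrite !scale0r.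
  by rewrite -[x in LHS]subr0 FB// f0 subr0.
have px := pospart_ge0 x; have qx := pospart_ge0 (- x).
have py := pospart_ge0 y; have qy := pospart_ge0 (- y).
have [a0|/ltW a0] := leP 0 a.
  rewrite -{1}(pospartB x) -{1}(pospartB y) scalerBr addrACA -opprD.
  rewrite FB ?vaddr_ge0 ?vscale_ge0// !fD ?vscale_ge0// !fZ//.
  by rewrite opprD addrACA -scalerBr.
have na : 0 <= - a by rewrite oppr_ge0.
have -> : a *: x + y = (- a *: pospart (- x) + pospart y)
    - (- a *: pospart x + pospart (- y)).
  rewrite opprD addrACA pospartB -scalerBr -opprB pospartB scalerN scaleNr.
  by rewrite opprK.
rewrite FB ?vaddr_ge0 ?vscale_ge0// !fD ?vscale_ge0// !fZ//.
by rewrite opprD addrACA -scalerBr -[X in - a *: X]opprB scalerN scaleNr opprK.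
Qed.

(** The positive part of an order bounded operator is
   [x |-> sup {U z | 0 <= z <= x}] on the cone; Riesz decomposition makes this
   supremum additive in [x]. *)
Lemma riesz_kantorovich U D : dedekind_complete E -> linear U -> positive_op D ->
  (forall x, 0 <= x -> U x <= D x) ->
  exists P, [/\ positive_op P, forall x, 0 <= x -> U x <= P x &
    forall V, positive_op V -> (forall x, 0 <= x -> U x <= V x) ->
      forall x, 0 <= x -> P x <= V x].
Proof.
move=> dE lU Dp UD; pose A x := [set U z | z in [set z : E | 0 <= z /\ z <= x]].
have AV V x : positive_op V -> (forall x, 0 <= x -> U x <= V x) -> ubound (A x) (V x).
  move=> Vp UV _ [z [z0 zx] <-]; apply: le_trans (UV _ z0) _.
  exact: positive_op_le.
have /choice[f fP] x : exists s, 0 <= x -> supremums (A x) s.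
  have [x0|nx] := pselect (0 <= x); last by exists 0.
  have [|s sP] := dE (A x); last by exists s.
  by split; [exists (U 0), 0|exists (D x); exact: AV].
have fub x z : 0 <= z -> z <= x -> U z <= f x.
  by move=> z0 zx; apply: (fP x (le_trans z0 zx)).1; exists z.
have fle x s : 0 <= x -> (forall z, 0 <= z -> z <= x -> U z <= s) -> f x <= s.
  by move=> x0 h; apply: (fP x x0).2 => _ [z [z0 zx] <-]; exact: h.
have fD x y : 0 <= x -> 0 <= y -> f (x + y) = f x + f y.
  move=> x0 y0; apply/le_anti/andP; split.
    apply: (fle) => [|z z0 zxy]; first exact: vaddr_ge0.
    rewrite -[z](subrK (z `&` x)) addrC op_linD// vleD//; apply: fub.
    - exact: vmeet_ge0.
    - exact: leIr.
    - by rewrite vsub_ge0 leIl.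
    - exact: riesz_remainder.
  rewrite -vlerBrDr; apply: (fle) => // x' x'0 x'x.
  rewrite vlerBrDr addrC -vlerBrDr; apply: (fle) => // y' y'0 y'y.
  by rewrite vlerBrDr -op_linD// fub ?vaddr_ge0// addrC vleD.
have f0 : f 0 = 0 by apply: (addIr (f 0)); rewrite -fD// !add0r.
have fZle (a : R) x : 0 < a -> 0 <= x -> f (a *: x) <= a *: f x.
  move=> a0 x0; have ai : 0 < a^-1 by rewrite invr_gt0.
  apply: (fle) => [|z z0 zax]; first by rewrite vscale_ge0// ltW.
  rewrite -(@vscale_pos_le _ _ a^-1)// vscaleK// -op_linZ//.
  by apply: fub; rewrite ?vscale_ge0 ?(ltW ai)// -(vscaleK x a0) vscale_pos_le.
have fZ (a : R) x : 0 <= a -> 0 <= x -> f (a *: x) = a *: f x.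
  rewrite le_eqVlt => /predU1P[<-|a0] x0; first by rewrite !scale0r.
  have ai : 0 < a^-1 by rewrite invr_gt0.
  apply/le_anti; rewrite fZle//= -(@vscale_pos_le _ _ a^-1)// vscaleK//.
  by rewrite -{1}(vscaleK x a0) fZle// vscale_ge0// ltW.
have [F lF Ff] := cone_extension fD fZ; exists F; split.
- split=> // x x0; rewrite Ff//; apply: le_trans (fub x 0 _ _) => //.
  by rewrite op_lin0.
- by move=> x x0; rewrite Ff// fub.
- by move=> V Vp UV x x0; rewrite Ff//; apply: (fP x x0).2; exact: AV.
Qed.

(** The supremum of [S] and [T] is [T] plus the positive part of [S - T]. *)
Lemma regular_vector_lattice : dedekind_complete E -> vector_lattice (regular_op E).
Proof.
move=> dE S T /regular_opP[lS [D SD]] /regular_opP[lT [D' TD']].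
have lST := op_lin_sub lS lT.
have DDp : positive_op (D \+ D').
  exact: dominators_positive (op_lin_add lS lT) (dominatorsD lS lT SD TD').
have SDx := (dominatorsP D lS).1 SD; have TDx := (dominatorsP D' lT).1 TD'.
have [|P [Pp STP Pmin]] := @riesz_kantorovich (S \- T) _ dE lST DDp.
  move=> x x0; rewrite /= vleD//.
    exact: le_trans (le_babs _) (SDx.2 _ x0).
  exact: le_trans (leN_babs _) (TDx.2 _ x0).
have lTP := op_lin_add lT Pp.1.
exists (T \+ P); split.
- apply/regular_opP; split=> //; exists (D' \+ P).
  apply: dominatorsD => //; first exact: Pp.1.
  apply/dominatorsP; first exact: Pp.1.
  by split=> [|x x0]; [exact: Pp.1|rewrite babs_id// Pp.2].
- by apply/op_leP => // x x0; rewrite /= addrC -vlerBlDr STP.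
- by apply/op_leP => // x x0; rewrite /= -[leLHS]addr0 vleD2l Pp.2.
move=> V /regular_opP[lV _] SV TV; apply/op_leP => // x x0.
rewrite /= addrC -vlerBrDr; apply: (Pmin (V \- T)) => // y y0.
by rewrite /= vleD2r; exact: op_le_pt SV y0.
Qed.

Lemma dominators_join T M : linear T ->
  is_join (regular_op E) T (\- T) M -> dominators T M.
Proof. by move=> lT [/regular_opP[lM _] TM NTM _]. Qed.

Lemma join_le_dominators T M D : linear T ->
  is_join (regular_op E) T (\- T) M -> dominators T D -> op_le M D.
Proof.
move=> lT [_ _ _ Mmin] TD.
have rD := positive_regular (dominators_positive lT TD).
by case: TD => _ TD NTD; exact: Mmin.
Qed.

Lemma modulus_exists T : dedekind_complete E -> regular_op E T ->
  exists M, [/\ dominators T M & forall D, dominators T D -> op_le M D].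
Proof.
move=> dE rT; have /regular_opP[lT [D TD]] := rT.
have rNT : regular_op E (\- T).
  apply/regular_opP; split; first exact: op_lin_opp.
  exists D; apply/dominatorsP; first exact: op_lin_opp.
  by split=> [|x x0]; rewrite ?babsN; move: TD => /(dominatorsP _ lT)[lD]; [|apply].
have [M MJ] := regular_vector_lattice dE rT rNT.
by exists M; split=> [|D']; [exact: dominators_join|exact: join_le_dominators].
Qed.

(** * Norms, closedness and the ideal property *)

Lemma opnorm_has_sup T : positive_op T ->
  has_sup [set `|T x| | x in [set x : E | `|x| <= 1]].
Proof.
move=> /positive_op_bounded[M M0 TM]; split.
  by exists `|T 0|; exists 0 => //=; rewrite normr0.
exists M => _ [x /= x1 <-]; apply: le_trans (TM x) _.
by rewrite -[leRHS]mulr1 ler_wpM2l.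
Qed.

Lemma opnorm_ge T x : positive_op T -> `|x| <= 1 -> `|T x| <= opnorm T.
Proof. by move=> Tp x1; apply: ub_le_sup; [exact: (opnorm_has_sup Tp).2|exists x]. Qed.

Lemma opnorm_ge0 T : positive_op T -> 0 <= opnorm T.
Proof. by move=> Tp; apply: le_trans (@opnorm_ge _ 0 Tp _); rewrite ?normr0. Qed.

Lemma norm_le_opnorm T x : positive_op T -> `|T x| <= opnorm T * `|x|.
Proof.
move=> Tp; have [->|x0] := eqVneq x 0.
  by rewrite (op_lin0 Tp.1) !normr0 mulr0.
have nx : 0 < `|x| by rewrite normr_gt0.
have nxi : `|(`|x|^-1)| = `|x|^-1 by rewrite ger0_norm ?invr_ge0.
have := @opnorm_ge _ (`|x|^-1 *: x) Tp; rewrite (op_linZ _ _ Tp.1) !normrZ nxi.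
by rewrite mulVf ?gt_eqF// ler_pdivrMl// mulrC; apply.
Qed.

Lemma opnorm_le S T : positive_op S -> positive_op T ->
  (forall x, 0 <= x -> S x <= T x) -> opnorm S <= opnorm T.
Proof.
move=> Sp Tp ST; apply: ge_sup; first exact: (opnorm_has_sup Sp).1.
move=> _ [x /= x1 <-]; apply: (@le_trans _ _ `|T (babs x)|).
  apply: norm_le; apply: le_trans (positive_op_babs _ Sp) _.
  by apply: le_trans (le_babs _); rewrite ST ?babs_ge0.
by apply: opnorm_ge; rewrite ?norm_babs.
Qed.

Lemma dominators_opnorm_ge0 T D : linear T -> dominators T D -> 0 <= opnorm D.
Proof. by move=> lT TD; apply: opnorm_ge0; exact: dominators_positive TD. Qed.

(** The modulus is the smallest dominator, so it has the smallest operator norm,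
   and it is itself among the limitedly LW dominators. *)
Lemma rlLW_norm_regular T : dedekind_complete E -> rlLW E T ->
  rlLW_norm T = regular_norm T.
Proof.
move=> dE rT; have /rlLWP[lT [D0 [TD0 oD0]]] := rT.
have [M [TM Mmin]] := modulus_exists dE (rlLW_regular rT).
have Mp := dominators_positive lT TM.
have oM : lLW M.
  have D0p := dominators_positive lT TD0.
  by apply: positive_lLW_le Mp D0p _ oD0 => x; exact: op_le_pt (Mmin _ TD0).
apply/le_anti/andP; split.
  apply: lb_le_inf; first by exists (opnorm D0), D0.
  move=> _ [D TD <-]; apply: (@le_trans _ _ (opnorm M)).
    apply: ge_inf; last by exists M.
    by exists 0 => _ [D' [TD' _] <-]; exact: dominators_opnorm_ge0 TD'.
  apply: opnorm_le => //; first exact: dominators_positive TD.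
  by move=> x; exact: op_le_pt (Mmin _ TD).
apply: lb_le_inf; first by exists (opnorm D0), D0.
move=> _ [D [TD _] <-]; apply: ge_inf; last by exists D.
by exists 0 => _ [D' TD' <-]; exact: dominators_opnorm_ge0 TD'.
Qed.

(** If [T - S] has a dominator [D] of small norm, the modulus of [T] is below
   the limitedly LW dominator of [S] plus [D], so its values are approximated
   by the order continuous part. *)
Lemma rlLW_closed : dedekind_complete E ->
  closed_in_norm regular_norm (rlLW E) (regular_op E).
Proof.
move=> dE T rT Tapp; have /regular_opP[lT _] := rT.
have [M [TM Mmin]] := modulus_exists dE rT.
have Mp := dominators_positive lT TM.
apply/rlLWP; split=> //; exists M; split=> //.
apply/(positive_lLWP Mp) => x x0; apply: ocp_approx => e e0.
have nx : 0 < `|x| + 1 by rewrite ltr_wpDl.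
have [S /rlLWP[lS [G [SG oG]]] TS] := Tapp _ (divr_gt0 e0 nx).
have lTS := op_lin_sub lT lS.
have [D TSD De] : exists2 D, dominators (T \- S) D & opnorm D < e / (`|x| + 1).
  have [|_ [D TSD <-] De] := inf_lt _ TS; last by exists D.
  have /regular_opP[_ [H TH]] := rT.
  exists (opnorm (H \+ G)), (H \+ G) => //.
  have -> : T \- S = T \+ (\- S) by [].
  apply: dominatorsD => //; first exact: op_lin_opp.
  apply/dominatorsP; first exact: op_lin_opp.
  move: SG => /(dominatorsP _ lS)[lG SG].
  by split=> // y y0; rewrite babsN SG.
have Dp := dominators_positive lTS TSD.
have Gp := dominators_positive lS SG.
exists (G x), (D x); split.
- exact: lLW_range oG x.
- apply: le_trans (norm_le_opnorm _ Dp) _.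
  apply: (@le_trans _ _ (e / (`|x| + 1) * (`|x| + 1))); last by rewrite divfK// gt_eqF.
  by rewrite ler_pM ?opnorm_ge0 ?lerDl// ltW.
rewrite !babs_id ?Mp.2 ?Gp.2 ?Dp.2//.
have TDG : dominators T (D \+ G).
  have -> : T = (T \- S) \+ S by apply/funext => y /=; rewrite subrK.
  exact: dominatorsD.
by rewrite addrC; exact: op_le_pt (Mmin _ TDG) x0.
Qed.

(** A supremum [U] of [S] and [T] lies between [S] and any positive operator
   above both, so the sum of dominators of [S] and [T] dominates [U]. *)
Lemma rlLW_sublattice : dedekind_complete E ->
  vector_sublattice (rlLW E) (regular_op E).
Proof.
move=> dE; split; [exact: regular_vector_lattice|exact: rlLW_subalgebra.1|].
move=> S T U /rlLWP[lS [D [SD oD]]] /rlLWP[lT [D' [TD' oD']]].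
move=> [/regular_opP[lU _] SU TU Umin].
have Dp := dominators_positive lS SD; have Dp' := dominators_positive lT TD'.
have DD := dominatorsD lS lT SD TD'.
have DDp := dominators_positive (op_lin_add lS lT) DD.
have SDx := (dominatorsP D lS).1 SD; have TDx := (dominatorsP D' lT).1 TD'.
apply/rlLWP; split=> //; exists (D \+ D'); split; last first.
  by apply/(positive_lLWP DDp) => x _; apply: ocpD; apply: lLW_range.
apply/dominatorsP => //; split=> [|x x0]; first exact: DDp.1.
rewrite babs_le; apply/andP; split.
  apply: (op_le_pt _ x0); apply: Umin; first exact: positive_regular.
    apply/op_leP => // [|y y0 /=]; first exact: DDp.1.
    by rewrite -[leLHS]addr0 vleD ?Dp'.2// (le_trans (le_babs _))// SDx.2.
  apply/op_leP => // [|y y0 /=]; first exact: DDp.1.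
  by rewrite -[leLHS]add0r vleD ?Dp.2// (le_trans (le_babs _))// TDx.2.
apply: (@le_trans _ _ (- S x)); first by rewrite vleN; exact: op_le_pt SU x0.
by rewrite /= -[leLHS]addr0 vleD ?Dp'.2// (le_trans (leN_babs _))// SDx.2.
Qed.

Lemma rlLW_order_ideal : dedekind_complete E -> order_ideal (rlLW E) (regular_op E).
Proof.
move=> dE; split; [exact: regular_vector_lattice|exact: rlLW_subalgebra.1|].
move=> S T SS TT /regular_opP[lS _] /rlLWP[lT [D [TD oD]]] SJ TJ SSTT.
have SD := dominators_join lS SJ.
have SSp := dominators_positive lS SD.
apply/rlLWP; split=> //; exists SS; split=> //.
have Dp := dominators_positive lT TD.
apply: positive_lLW_le SSp Dp _ oD => x; apply: op_le_pt.
exact: op_le_trans SSTT (join_le_dominators lT TJ TD).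
Qed.

End RieszKantorovich.

Theorem theorem2p3p7 (R : realType) (E : banachLatticeType R) :
  (subalgebra (rlLW E) (regular_op E) /\
   (rlLW E = regular_op E <-> lLW (@idfun E))) /\
  (dedekind_complete E ->
    [/\ (forall T : E -> E, rlLW E T -> rlLW_norm T = regular_norm T),
        closed_in_norm regular_norm (rlLW E) (regular_op E),
        riesz_subalgebra (rlLW E) (regular_op E) &
        order_ideal (rlLW E) (regular_op E)]).
Proof.
split; first by split; [exact: rlLW_subalgebra|exact: rlLW_eq_regular].
move=> dE; split.
- by move=> T; exact: rlLW_norm_regular.
- exact: rlLW_closed.
- by split; [exact: rlLW_subalgebra|exact: rlLW_sublattice].
- exact: rlLW_order_ideal.
Qed.
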